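(* Let $(X,r)$ be a finite left non-degenerate idempotent set-theoretic solution of the Yang--Baxter equation. Then the (disjoint) union $T(G^e):=\bigcup_{u\in\Lambda}T(G_u)$ is a left cancellative simple semigroup for the binary operation $\circ$ defined as \[t_{u,x}\circ t_{v,y}:=t_{v,\lambda_{dx}(y)}\] for $u,v\in\Lambda$, $x\in X_u$ and $y\in X_v$. Its maximal subgroups are the groups $T(G_u)$, $u\in\Lambda$. Hence: \begin{enumerate} \item $T(G_u)\cong T(G_v)$ for all $u,v\in\Lambda$. \item $T(G^e)\cong\mathcal{M}(T(G_u),1,|\Lambda|,J)$ for some (and thus any) $u\in\Lambda$. \item $|X|=|\Lambda|\cdot|T(G_u)|$ for any $u\in\Lambda$. \item $X=\bigcup_{u\in\Lambda}X_u$ is a disjoint union and $|X_u|=|X_v|$ for all $u,v\in\Lambda$. \end{enumerate}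
   Context: A set-theoretic solution of the Yang--Baxter equation is a pair $(X,r)$ with $X$ a non-empty set and $r\colon X\times X\to X\times X$ a map satisfying $(r\times\mathrm{id})(\mathrm{id}\times r)(r\times\mathrm{id})=(\mathrm{id}\times r)(r\times\mathrm{id})(\mathrm{id}\times r)$. Write $r(x,y)=(\lambda_x(y),\rho_y(x))$. It is finite if $X$ is finite, left non-degenerate if every $\lambda_x\colon X\to X$ is bijective, and idempotent if $r^2=r$. The diagonal map is $q\colon X\to X$, $q(x)=\lambda_x^{-1}(x)$, and $\Lambda=q(X)$. The structure monoid is $M=M(X,r)=\langle X\mid x\circ y=\lambda_x(y)\circ\rho_y(x),\ x,y\in X\rangle$ and the structure semigroup is $S=S(X,r)=M\setminus\{1\}$. For $(X,r)$ left non-degenerate and idempotent, the derived structure monoid is $A=A(X,r)=\langle X\mid x+y=y+y,\ x,y\in X\rangle$ (written additively); every non-zero element is uniquely of the form $nx$ with $n\ge1$, $x\in X$, one has $nx+my=(n+m)y$ for $m\ge1$, and its length is $|nx|=n$. Each $\lambda_x$ extends to an automorphism of $A$, and this yields a monoid homomorphism $\lambda\colon(M,\circ)\to\mathrm{Aut}(A,+)$, $m\mapsto\lambda_m$. There is a bijection $\pi\colon M\to A$ with $\pi(x)=x$ for $x\in X$ and $\pi(m\circ m')=\pi(m)+\lambda_m(\pi(m'))$. For $a\in A$ write $\lambda_a=\lambda_{\pi^{-1}(a)}$. Identify $m\in M$ with $(\pi(m),\lambda_m)\in A\rtimes\mathrm{Aut}(A,+)$; thus $M=\{(a,\lambda_a):a\in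 A\}$, the generator $x\in X$ is $(x,\lambda_x)$, and $(a,\lambda_a)\circ(b,\lambda_b)=(a+\lambda_a(b),\lambda_a\lambda_b)$ with $\lambda_{a+\lambda_a(b)}=\lambda_a\lambda_b$. For $u\in\Lambda$, $S_u=\{(a,\lambda_a)\in S:\lambda_a^{-1}(a)=|a|u\}$; these are cancellative subsemigroups of $S$ and $S$ is their disjoint union. The symbol $d$ denotes a fixed positive multiple of the exponent of the permutation group $\mathrm{gr}(\lambda_x:x\in X)\subseteq\mathrm{Sym}(X)$. The element $c_u=(du,\mathrm{id})$ lies in $S_u$, is central in $S_u$, and inverting it yields the group of quotients $G_u=S_u\circ\langle c_u\rangle^{-1}$ of $S_u$; the elements of finite order of $G_u$ form a finite subgroup $T(G_u)$. The groups $G_u$, $u\in\Lambda$, are regarded as pairwise disjoint. Put $X_u=\{x\in X:\lambda_{dx}(u)=x\}=\{x\in X:(dx,\lambda_{dx})\in S_u\}$ and, for $x\in X_u$, $t_{u,x}=(dx,\lambda_{dx})\circ c_u^{-1}\in G_u$. One has $T(G_u)=\{t_{u,x}:x\in X_u\}$, with $t_{u,x}\neq t_{u,y}$ for distinct $x,y\in X_u$. A semigroup is simple if it has no proper non-empty two-sided ideals. For a group $G$ and positive integer $m$, $\mathcal{M}(G,1,m,J)$ is the semigroup of triples $(g,1,j)$, $g\in G$, $1\le j\le m$, with multiplication $(g,1,j)(h,1,l)=(gh,1,l)$. *)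

(* Defs.v *)
From HB Require Import structures.
From mathcomp Require Import all_boot all_order all_fingroup all_solvable.
From mathcomp Require Import boolp generic_quotient.

Set Implicit Arguments.
Unset Strict Implicit.
Unset Printing Implicit Defensive.

Local Open Scope group_scope.
Local Open Scope quotient_scope.

Section Semigroups.
Variables (T : Type) (op : T -> T -> T).

Definition left_cancellative := forall a b c : T, op a b = op a c -> b = c.

Definition is_ideal (I : T -> Prop) :=
  (exists a, I a) /\ forall a b, I a -> I (op a b) /\ I (op b a).

Definition simple_semigroup :=
  (exists a : T, True) /\ forall I : T -> Prop, is_ideal I -> forall a, I a.

Definition is_subgroup (H : T -> Prop) :=
  (forall a b, H a -> H b -> H (op a b)) /\
  exists2 e, H e & forall a, H a ->
    [/\ op e a = a, op a e = a &
        exists2 b, H b & op a b = e /\ op b a = e].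

Definition is_maximal_subgroup (H : T -> Prop) :=
  is_subgroup H /\
  forall K : T -> Prop, is_subgroup K -> (forall a, H a -> K a) ->
    forall a, K a -> H a.

End Semigroups.

Definition semigroup_iso (T U : Type) (opT : T -> T -> T) (opU : U -> U -> U) :=
  exists2 f : T -> U, bijective f &
    forall a b, f (opT a b) = opU (f a) (f b).

Definition rees (G : Type) (m : nat) : Type := G * 'I_1 * 'I_m.

Definition rees_mul (G : groupType) (m : nat) (a b : rees G m) : rees G m :=
  (a.1.1 * b.1.1, a.1.2, b.2).

Section Presentation.
Variables (X : choiceType) (R : seq X -> seq X -> Prop).

Inductive congruent : seq X -> seq X -> Prop :=
| congruent_rel p u v s : R u v -> congruent (p ++ u ++ s) (p ++ v ++ s)
| congruent_refl u : congruent u u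
| congruent_sym u v : congruent u v -> congruent v u
| congruent_trans u v w : congruent u v -> congruent v w -> congruent u w.

Definition congruentb : rel (seq X) := fun u v => `[< congruent u v >].

Lemma congruentb_equiv : equiv_class_of congruentb.
Proof.
split=> [u|u v|v u w].
- exact/asboolP/congruent_refl.
- by apply/asboolP/asboolP; apply: congruent_sym.
- by move=> /asboolP uv /asboolP vw; apply/asboolP; apply: congruent_trans vw.
Qed.

Canonical congruentb_equiv_rel := EquivRelPack congruentb_equiv.

Definition presented : Type := {eq_quot congruentb_equiv_rel}.

HB.instance Definition _ := Choice.on presented.
HB.instance Definition _ := Quotient.on presented.
HB.instance Definition _ := EqQuotient.on presented.

Definition word (w : seq X) : presented := \pi_presented w.

Lemma wordP u v : word u = word v <-> congruent u v.
Proof. by split=> [/eqquotP/asboolP|h] //; apply/eqquotP/asboolP. Qed.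

Lemma word_repr (a : presented) : word (repr a) = a.
Proof. exact: reprK. Qed.

Lemma congruent_repr w : congruent (repr (word w)) w.
Proof. by apply/wordP; rewrite word_repr. Qed.

Lemma congruent_cat u u' v v' :
  congruent u u' -> congruent v v' -> congruent (u ++ v) (u' ++ v').
Proof.
move=> uu' vv'; apply: (@congruent_trans _ (u' ++ v)).
  elim: uu' => {u u'} [p u u' s ruu'|u|u u' _|u u' u'' _ IH1 _ IH2].
  - by rewrite -!catA; apply: congruent_rel.
  - exact: congruent_refl.
  - exact: congruent_sym.
  - exact: congruent_trans IH2.
elim: vv' => {v v'} [p v v' s rvv'|v|v v' _|v v' v'' _ IH1 _ IH2].
- by rewrite [u' ++ p ++ _]catA [u' ++ p ++ _]catA; apply: congruent_rel.
- exact: congruent_refl.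
- exact: congruent_sym.
- exact: congruent_trans IH2.
Qed.

Definition presented_mul (a b : presented) : presented :=
  word (repr a ++ repr b).

Lemma word_cat u v : presented_mul (word u) (word v) = word (u ++ v).
Proof.
by apply/wordP/congruent_cat; apply: congruent_repr.
Qed.

Lemma presented_mulA : associative presented_mul.
Proof.
move=> a b c; rewrite -(word_repr a) -(word_repr b) -(word_repr c).
by rewrite !word_cat catA.
Qed.

Lemma presented_mul1g : left_id (word [::]) presented_mul.
Proof. by move=> a; rewrite -(word_repr a) word_cat. Qed.

Lemma presented_mulg1 : right_id (word [::]) presented_mul.
Proof. by move=> a; rewrite -(word_repr a) word_cat cats0. Qed.

HB.instance Definition _ := isMonoid.Build presented
  presented_mulA presented_mul1g presented_mulg1.

Definition generator (x : X) : presented := word [:: x].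

Lemma wordM u v : word (u ++ v) = word u * word v.
Proof. by rewrite -word_cat. Qed.

Lemma word_cons x w : word (x :: w) = generator x * word w.
Proof. by rewrite -wordM. Qed.

Lemma word_rcons w x : word (rcons w x) = word w * generator x.
Proof. by rewrite -wordM cats1. Qed.

Lemma congruent_invariant (T : Type) (f : seq X -> T) :
  (forall p u v s, R u v -> f (p ++ u ++ s) = f (p ++ v ++ s)) ->
  forall u v, congruent u v -> f u = f v.
Proof.
by move=> fR u v; elim=> {u v} [p u v s /fR| |u v _ ->|u v w _ -> _ ->].
Qed.

Lemma presented_ind (P : presented -> Prop) :
  P 1 -> (forall a x, P a -> P (a * generator x)) -> forall a, P a.
Proof.
move=> P1 PM a; rewrite -(word_repr a).
by elim/last_ind: (repr a) => // w x IH; rewrite word_rcons; apply: PM.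
Qed.

End Presentation.

Section Solutions.
Variables (X : Type) (r : X * X -> X * X).

Definition r_id (t : X * X * X) : X * X * X :=
  let: (x, y, z) := t in let: (x', y') := r (x, y) in (x', y', z).

Definition id_r (t : X * X * X) : X * X * X :=
  let: (x, y, z) := t in let: (y', z') := r (y, z) in (x, y', z').

Definition yang_baxter :=
  forall t, r_id (id_r (r_id t)) = id_r (r_id (id_r t)).

Definition left_nondegenerate :=
  forall x, bijective (fun y => (r (x, y)).1).

Definition idempotent_map := forall p, r (r p) = r p.

End Solutions.

Record solution := Solution {
  carrier :> finType;
  sol_map : carrier * carrier -> carrier * carrier;
  sol_nonempty : 0 < #|carrier|;
  sol_yang_baxter : yang_baxter sol_map;
  sol_left_nondegenerate : left_nondegenerate sol_map;
  sol_idempotent : idempotent_map sol_map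
}.

Section StructureMonoids.
Variable X : solution.

Definition lam (x y : X) : X := (sol_map (x, y)).1.
Definition rho (y x : X) : X := (sol_map (x, y)).2.

Lemma lam_inj x : injective (lam x).
Proof. exact: bij_inj (sol_left_nondegenerate x). Qed.

(** lambda_x as a permutation. In {perm X}, [(s * t) y = t (s y)], so a
    composite of functions is the product in the opposite order. *)
Definition lam_perm (x : X) : {perm X} := perm (@lam_inj x).

Definition diag (x : X) : X := (lam_perm x)^-1 x.

Definition Lambda : {set X} := diag @: setT.

Definition perm_group : {set {perm X}} := <<lam_perm @: setT>>.

Definition M_rel (u v : seq X) : Prop :=
  exists x y, u = [:: x; y] /\ v = [:: lam x y; rho y x].
Definition M : Type := presented M_rel.
HB.instance Definition _ := Monoid.on M.

Definition genM (x : X) : M := generator M_rel x.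

(** The derived structure monoid A(X, r), in multiplicative notation: [a * b]
    is a + b, [1] is 0 and [genA x ^+ n] is nx. *)
Definition A_rel (u v : seq X) : Prop :=
  exists x y, u = [:: x; y] /\ v = [:: y; y].
Definition A : Type := presented A_rel.
HB.instance Definition _ := Monoid.on A.

Definition genA (x : X) : A := generator A_rel x.

Lemma sol_mapE x y : sol_map (x, y) = (lam x y, rho y x).
Proof. by rewrite /lam /rho -surjective_pairing. Qed.

Lemma lam_lam x y z : lam x (lam y z) = lam (lam x y) (lam (rho y x) z).
Proof.
have := sol_yang_baxter (x, y, z).
by rewrite /r_id /id_r; do 3 (rewrite ?sol_mapE /=); case=> <-.
Qed.

Lemma lam_rho x y : lam (lam x y) (rho y x) = lam x y.
Proof.
have := sol_idempotent (x, y).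
by rewrite !sol_mapE => -[].
Qed.

Definition lam_word (w : seq X) : {perm X} :=
  foldr (fun x s => s * lam_perm x) 1 w.

Lemma lam_word_cat u v : lam_word (u ++ v) = lam_word v * lam_word u.
Proof. by elim: u => /= [|x u ->]; rewrite ?mulg1 ?mulgA. Qed.

Definition lamM (m : M) : {perm X} := lam_word (repr m).

Lemma lamM_word w : lamM (word M_rel w) = lam_word w.
Proof.
apply: (congruent_invariant (f := lam_word) _ (congruent_repr M_rel w)).
move=> p u v s [x [y [-> ->]]]; rewrite !lam_word_cat /=.
congr (_ * _ * _); rewrite !mul1g; apply/permP => z.
by rewrite !permM !permE lam_lam.
Qed.

Lemma lamM_mul (m n : M) : lamM (m * n) = lamM n * lamM m.
Proof.
by rewrite -[m]word_repr -[n]word_repr -wordM !lamM_word lam_word_cat.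
Qed.

Lemma lamM_one : lamM 1 = 1.
Proof. exact: (lamM_word [::]). Qed.

Lemma lamM_gen x : lamM (genM x) = lam_perm x.
Proof. by rewrite lamM_word /= mul1g. Qed.

Definition autA (s : {perm X}) (a : A) : A := word A_rel (map s (repr a)).

Lemma autA_word s w : autA s (word A_rel w) = word A_rel (map s w).
Proof.
apply/wordP; move: (repr _) (congruent_repr A_rel w) => v.
elim=> {v w} [p u v t [x [y [-> ->]]]|u|u v _|
  u v t _ IH1 _ IH2].
- by rewrite !map_cat; apply: congruent_rel; exists (s x), (s y).
- exact: congruent_refl.
- exact: congruent_sym.
- exact: congruent_trans IH2.
Qed.

Lemma autA_mul s (a b : A) : autA s (a * b) = autA s a * autA s b.
Proof.
by rewrite -[a]word_repr -[b]word_repr -wordM !autA_word map_cat wordM.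
Qed.

Lemma autA_one s : autA s 1 = 1.
Proof. exact: (autA_word s [::]). Qed.

Lemma autA_gen s x : autA s (genA x) = genA (s x).
Proof. exact: autA_word. Qed.

Lemma autA_id a : autA 1 a = a.
Proof.
rewrite -[a]word_repr autA_word; congr word.
by rewrite -[RHS]map_id; apply: eq_map => x; rewrite perm1.
Qed.

Lemma autA_perm_mul s t a : autA (s * t) a = autA t (autA s a).
Proof.
rewrite -[a]word_repr !autA_word -map_comp; congr word.
by apply: eq_map => x; rewrite permM.
Qed.

Lemma autAK s : cancel (autA s) (autA s^-1).
Proof. by move=> a; rewrite -autA_perm_mul mulgV autA_id. Qed.

Lemma autAKV s : cancel (autA s^-1) (autA s).
Proof. by move=> a; rewrite -autA_perm_mul mulVg autA_id. Qed.

Lemma autA_expg s a n : autA s (a ^+ n) = autA s a ^+ n.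
Proof.
by elim: n => [|n IH]; rewrite ?autA_one // !expgS autA_mul IH.
Qed.

Definition len (a : A) : nat := size (repr a).

Lemma len_word w : len (word A_rel w) = size w.
Proof.
apply: (congruent_invariant (f := size) _ (congruent_repr A_rel w)).
by move=> p u v s [x [y [-> ->]]]; rewrite !size_cat.
Qed.

Lemma len_mul (a b : A) : len (a * b) = (len a + len b)%N.
Proof.
by rewrite -[a]word_repr -[b]word_repr -wordM !len_word size_cat.
Qed.

Lemma len_gen x : len (genA x) = 1%N.
Proof. exact: len_word. Qed.

Lemma len_expg x n : len (genA x ^+ n) = n.
Proof.
by elim: n => [|n IH]; rewrite ?(len_word [::]) // expgS len_mul IH len_gen.
Qed.

Lemma len_autA s a : len (autA s a) = len a.
Proof. by rewrite -[a]word_repr autA_word !len_word size_map. Qed.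

Lemma genA_mul x y : genA x * genA y = genA y * genA y.
Proof.
rewrite -!wordM; apply/wordP.
have xy : A_rel [:: x; y] [:: y; y] by exists x, y.
exact: (congruent_rel [::] [::] xy).
Qed.

Lemma mulA_gen a y : a * genA y = genA y ^+ (len a).+1.
Proof.
elim/presented_ind: a => [|a x IH]; first by rewrite mul1g (len_word [::]).
rewrite -mulgA genA_mul mulgA IH len_mul len_gen addn1.
by rewrite -expgSr.
Qed.

Lemma mulA_expg a y n : 0 < n -> a * genA y ^+ n = genA y ^+ (len a + n).
Proof.
by case: n => // n _; rewrite expgS mulgA mulA_gen -expgnDr addSnnS.
Qed.

Lemma genA_expg_inj x y n : 0 < n -> genA x ^+ n = genA y ^+ n -> x = y.
Proof.
have genAX z k : genA z ^+ k = word A_rel (nseq k z).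
  by elim: k => // k IH; rewrite expgS IH -word_cons.
have lastX T (z : T) k : last z (nseq k z) = z by elim: k.
case: n => // n _; rewrite !genAX => /wordP.
move=> /(congruent_invariant (f := last x)) /= exy.
by rewrite -[LHS](lastX _ x n) -[RHS](lastX _ y n); apply: exy => p u v s
  [a [b [-> ->]]]; rewrite !last_cat.
Qed.

Definition pi_word (w : seq X) : A :=
  foldr (fun x a => genA x * autA (lam_perm x) a) 1 w.

Lemma pi_word_cat u v :
  pi_word (u ++ v) = pi_word u * autA (lam_word u) (pi_word v).
Proof.
elim: u => /= [|x u ->]; first by rewrite mul1g autA_id.
by rewrite autA_mul mulgA autA_perm_mul.
Qed.

Definition piM (m : M) : A := pi_word (repr m).

Lemma piM_word w : piM (word M_rel w) = pi_word w.
Proof.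
apply: (congruent_invariant (f := pi_word) _ (congruent_repr M_rel w)).
move=> p u v s [x [y [-> ->]]]; rewrite !pi_word_cat.
have -> : lam_word [:: x; y] = lam_word [:: lam x y; rho y x].
  rewrite /= !mul1g; apply/permP => z.
  by rewrite !permM !permE lam_lam.
congr (_ * autA _ (_ * _)) => /=.
by rewrite !autA_one !mulg1 !autA_gen !permE lam_rho genA_mul.
Qed.

Lemma piM_gen x : piM (genM x) = genA x.
Proof. by rewrite piM_word /= autA_one mulg1. Qed.

Lemma piM_one : piM 1 = 1.
Proof. exact: (piM_word [::]). Qed.

Lemma piM_mul (m n : M) : piM (m * n) = piM m * autA (lamM m) (piM n).
Proof.
rewrite -[m]word_repr -[n]word_repr -wordM !piM_word pi_word_cat.
by rewrite lamM_word.
Qed.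

(** The inverse of pi, characterised by [piM_inv 1 = 1] and
    [piM_inv (a * genA x) = m * genM (lambda_m^-1 x)] where [m = piM_inv a]. *)
Definition pi_inv_word : seq X -> M :=
  foldl (fun m x => m * genM ((lamM m)^-1 x)) 1.

Definition piM_inv (a : A) : M := pi_inv_word (repr a).

Lemma genM_mul x y :
  genM x * genM ((lam_perm x)^-1 y) = genM y * genM ((lam_perm y)^-1 y).
Proof.
set z := (lam_perm x)^-1 y.
have lamxz : lam x z = y by have := permKV (lam_perm x) y; rewrite permE.
have -> : (lam_perm y)^-1 y = rho z x.
  by apply: (@perm_inj _ (lam_perm y)); rewrite permKV permE -lamxz lam_rho.
rewrite -!wordM -lamxz; apply/wordP.
have xz : M_rel [:: x; z] [:: lam x z; rho z x] by exists x, z.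
exact: (congruent_rel [::] [::] xz).
Qed.

Lemma piM_inv_word w : piM_inv (word A_rel w) = pi_inv_word w.
Proof.
apply: (congruent_invariant (f := pi_inv_word) _ (congruent_repr A_rel w)).
move=> p u v s [x [y [-> ->]]]; rewrite /pi_inv_word !foldl_cat /=.
congr foldl; set m := foldl _ _ _.
have key z : m * genM ((lamM m)^-1 z) *
    genM ((lamM (m * genM ((lamM m)^-1 z)))^-1 y) =
  m * (genM ((lamM m)^-1 z) * genM ((lam_perm ((lamM m)^-1 z))^-1
      ((lamM m)^-1 y))).
  by rewrite lamM_mul lamM_gen invMg permM mulgA.
by rewrite !key genM_mul.
Qed.

Lemma piM_inv_mul_gen a x :
  piM_inv (a * genA x) =
  piM_inv a * genM ((lamM (piM_inv a))^-1 x).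
Proof.
rewrite -[a]word_repr -word_rcons !piM_inv_word.
by rewrite /pi_inv_word -cats1 foldl_cat.
Qed.

Lemma piM_invK : cancel piM_inv piM.
Proof.
elim/presented_ind => [|a x IH].
  by rewrite (piM_inv_word [::]) piM_one.
by rewrite piM_inv_mul_gen piM_mul IH piM_gen autA_gen permKV.
Qed.

Lemma piMK : cancel piM piM_inv.
Proof.
elim/presented_ind => [|m x IH]; first by rewrite piM_one (piM_inv_word [::]).
by rewrite piM_mul piM_gen autA_gen piM_inv_mul_gen IH permK.
Qed.

Lemma piM_inj : injective piM.
Proof. exact: can_inj piMK. Qed.

Definition lamA (a : A) : {perm X} := lamM (piM_inv a).

Definition S_mem (u : X) : pred M := fun m =>
  (m != 1) && (autA (lamM m)^-1 (piM m) == genA u ^+ len (piM m)).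

Lemma S_memP u m :
  reflect (m != 1 /\ piM m = genA (lamM m u) ^+ len (piM m)) (S_mem u m).
Proof.
apply: (iffP andP) => -[m1 mu]; split => //.
  by rewrite -autA_gen -autA_expg -(eqP mu) autAKV.
by rewrite mu len_expg autA_expg autA_gen permK.
Qed.

Lemma len_piM_gt0 (m : M) : (0 < len (piM m)) = (m != 1).
Proof.
rewrite -[m]piMK piM_invK; elim/presented_ind: (piM m) => [|a x _].
  by rewrite (piM_inv_word [::]) (len_word [::]) eqxx.
rewrite len_mul len_gen addn1; apply/esym/eqP => /(congr1 piM).
rewrite piM_one piM_invK => /(congr1 len).
by rewrite len_mul len_gen addn1 (len_word [::]).
Qed.

Lemma len_piM_mul (m n : M) : len (piM (m * n)) = (len (piM m) + len (piM n))%N.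
Proof. by rewrite piM_mul len_mul len_autA. Qed.

Lemma S_memM u m n : S_mem u m -> S_mem u n -> S_mem u (m * n).
Proof.
move=> /S_memP[m1 mu] /S_memP[n1 nu]; apply/S_memP; split.
  by rewrite -len_piM_gt0 len_piM_mul addn_gt0 len_piM_gt0 m1.
rewrite len_piM_mul piM_mul nu autA_expg autA_gen lamM_mul permM.
by rewrite mulA_expg ?len_expg // -?nu ?len_piM_gt0.
Qed.

Lemma S_memX u m n : S_mem u m -> 0 < n -> S_mem u (m ^+ n).
Proof.
move=> mu; case: n => // n _; elim: n => // n IH.
by rewrite expgS; apply: S_memM.
Qed.

Lemma lamM_expg (m : M) n : lamM (m ^+ n) = lamM m ^+ n.
Proof.
by elim: n => [|n IH]; rewrite ?lamM_one // expgS lamM_mul IH -expgSr.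
Qed.

Lemma len_piM_expg (m : M) n : len (piM (m ^+ n)) = (n * len (piM m))%N.
Proof.
elim: n => [|n IH]; first by rewrite piM_one (len_word [::]).
by rewrite expgS len_piM_mul IH mulSn.
Qed.

(** An element of S_u is determined by its length and by [lamM m u]. *)
Lemma S_mem_inj u m n : S_mem u m -> S_mem u n ->
  len (piM m) = len (piM n) -> lamM m u = lamM n u -> m = n.
Proof.
move=> /S_memP[_ mu] /S_memP[_ nu] emn luv; apply: piM_inj.
by rewrite mu nu emn luv.
Qed.

Lemma lamM_perm_group (m : M) : lamM m \in perm_group.
Proof.
elim/presented_ind: m => [|m x IH]; first by rewrite lamM_one group1.
by rewrite lamM_mul lamM_gen groupM // mem_gen ?imset_f.
Qed.

End StructureMonoids.

Record exponent_multiple (X : solution) := ExponentMultiple {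
  dval :> nat;
  d_gt0 : 0 < dval;
  d_exponent : exponent (perm_group X) %| dval
}.

Section QuotientGroups.
Variables (X : solution) (d : exponent_multiple X).

Definition LambdaT : finType := {u : X | u \in Lambda X}.

Lemma lamM_d (m : M X) : lamM m ^+ d = 1.
Proof. by move/exponentP: (d_exponent d); apply; apply: lamM_perm_group. Qed.

(** c_u = (du, id). *)
Definition cM (u : LambdaT) : M X := piM_inv (genA (val u) ^+ d).

Lemma d2_gt0 : 0 < d.*2.-1.
Proof. by case: (dval d) (d_gt0 d) => // n _; rewrite doubleS. Qed.

Lemma S_mem_gen (x : X) : S_mem (diag x) (genM x).
Proof.
apply/S_memP; rewrite -len_piM_gt0 piM_gen len_gen; split=> //.
by rewrite lamM_gen permKV.
Qed.

Lemma cM_spec u : S_mem (val u) (cM u) /\ lamM (cM u) = 1.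
Proof.
case: u => u uL; rewrite /cM /=; have /imsetP[x _ ->] := uL.
have xS := S_memX (S_mem_gen x) (d_gt0 d).
have x1 : lamM (genM x ^+ d) = 1 by rewrite lamM_expg lamM_d.
suff -> : piM_inv (genA (diag x) ^+ d) = genM x ^+ d by [].
apply: (can_inj (@piMK X)); rewrite piM_invK.
have /S_memP[_ ->] := xS; rewrite x1 perm1.
by rewrite len_piM_expg piM_gen len_gen muln1.
Qed.

Lemma len_cM u : len (piM (cM u)) = d.
Proof. by rewrite piM_invK len_expg. Qed.

Definition Su (u : LambdaT) : Type := {m : M X | S_mem (val u) m}.
HB.instance Definition _ u := SubChoice.on (Su u).

Lemma S_mulg_closed (u : LambdaT) : mulg_closed (S_mem (val u)).
Proof. by move=> a b; apply: S_memM. Qed.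

HB.instance Definition _ (u : LambdaT) :=
  SubChoice_isSubSemigroup.Build (M X) (S_mem (val u)) (Su u)
    (@S_mulg_closed u).

Definition cS u : Su u := exist _ (cM u) (cM_spec u).1.

Lemma lamM_cMX u n : lamM (cM u ^+ n) = 1.
Proof. by rewrite lamM_expg (cM_spec u).2 expg1n. Qed.

Lemma S_mem_cX u m n : S_mem (val u) m -> S_mem (val u) (m * cM u ^+ n).
Proof.
case: n => [|n] mu; first by rewrite mulg1.
by apply/S_memM/S_memX => //; case: (cM_spec u).
Qed.

Lemma S_cX_eq u (a b : Su u) m n :
  (val a * cM u ^+ m == val b * cM u ^+ n) =
  (len (piM (val a)) + m * d == len (piM (val b)) + n * d)%N &&
  (lamM (val a) (val u) == lamM (val b) (val u)).
Proof.
have lamc (w : M X) k : lamM (w * cM u ^+ k) = lamM w.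
  by rewrite lamM_mul lamM_cMX mul1g.
have lenc (w : M X) k : len (piM (w * cM u ^+ k)) = (len (piM w) + k * d)%N.
  by rewrite len_piM_mul len_piM_expg len_cM.
apply/eqP/andP => [eab|[/eqP elen /eqP elam]].
  by rewrite -!lenc -(lamc (val a) m) -(lamc (val b) n) eab.
apply: (S_mem_inj (u := val u)); rewrite ?S_mem_cX ?(valP a) ?(valP b) //.
- by rewrite !lenc.
- by rewrite !lamc.
Qed.

(** A pair (a, n) stands for the quotient of a by the n-th power of c_u. *)
Definition quot_eq u : rel (Su u * nat) := fun p q =>
  val p.1 * cM u ^+ q.2 == val q.1 * cM u ^+ p.2.

Lemma quot_eqE u (p q : Su u * nat) : quot_eq p q =
  (len (piM (val p.1)) + q.2 * d == len (piM (val q.1)) + p.2 * d)%N &&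
  (lamM (val p.1) (val u) == lamM (val q.1) (val u)).
Proof. exact: S_cX_eq. Qed.

Lemma quot_eq_equiv u : equiv_class_of (@quot_eq u).
Proof.
split=> [p|p q|q p s].
- by rewrite quot_eqE !eqxx.
- by rewrite /quot_eq eq_sym.
rewrite !quot_eqE => /andP[/eqP epq /eqP lpq] /andP[/eqP eqs /eqP lqs].
rewrite lpq lqs eqxx andbT -(eqn_add2r (q.2 * d)).
by rewrite addnAC epq addnAC eqs addnAC.
Qed.

Canonical quot_eq_equiv_rel u := EquivRelPack (quot_eq_equiv u).

Definition Gu (u : LambdaT) : Type := {eq_quot (quot_eq_equiv_rel u)}.
HB.instance Definition _ u := Choice.on (Gu u).
HB.instance Definition _ u := Quotient.on (Gu u).
HB.instance Definition _ u := EqQuotient.on (Gu u).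

Definition frac u (a : Su u) (n : nat) : Gu u := \pi_(Gu u) (a, n).

Lemma fracP u (a b : Su u) m n :
  frac a m = frac b n <-> val a * cM u ^+ n = val b * cM u ^+ m.
Proof.
rewrite /frac; split=> [/eqquotP/eqP //|eab].
by apply/eqquotP/eqP.
Qed.

Lemma frac_eqE u (a b : Su u) m n : frac a m = frac b n <->
  (len (piM (val a)) + n * d = len (piM (val b)) + m * d)%N /\
  lamM (val a) (val u) = lamM (val b) (val u).
Proof.
apply: (iff_trans (fracP a b m n)); split.
  by move/eqP; rewrite S_cX_eq => /andP[/eqP ? /eqP ?].
by move=> [e1 e2]; apply/eqP; rewrite S_cX_eq e1 e2 !eqxx.
Qed.

Lemma frac_repr u (g : Gu u) : frac (repr g).1 (repr g).2 = g.
Proof. by rewrite /frac -surjective_pairing reprK. Qed.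

Lemma frac_ind u (P : Gu u -> Prop) :
  (forall a n, P (frac a n)) -> forall g, P g.
Proof. by move=> Pf g; rewrite -(frac_repr g). Qed.

Lemma cMX_central (u : LambdaT) (a : Su u) n :
  cM u ^+ n * val a = val a * cM u ^+ n.
Proof.
case: n => [|n]; first by rewrite mul1g mulg1.
have cu : S_mem (val u) (cM u ^+ n.+1) by apply/S_memX => //; case: (cM_spec u).
apply: (S_mem_inj (u := val u)); try by apply: S_memM => //; apply: (valP a).
  by rewrite !len_piM_mul addnC.
by rewrite !lamM_mul lamM_cMX mulg1 mul1g.
Qed.

Definition mulG u (g h : Gu u) : Gu u :=
  frac ((repr g).1 * (repr h).1) ((repr g).2 + (repr h).2).

Lemma mulG_frac u (a b : Su u) m n :
  mulG (frac a m) (frac b n) = frac (a * b) (m + n).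
Proof.
have /fracP := frac_repr (frac a m); have /fracP := frac_repr (frac b n).
rewrite /mulG; case: (repr (frac a m)) => a' m' /=.
case: (repr (frac b n)) => b' n' /= eb ea.
apply/fracP; rewrite !valM !expgnDr.
rewrite -!mulgA [val b' * _]mulgA -cMX_central -[_ * val b' * _]mulgA eb.
by rewrite mulgA ea -!mulgA; congr (_ * _); rewrite !mulgA cMX_central.
Qed.

Definition oneG u : Gu u := frac (cS u) 1.

(** As [a ^+ d] is the |a|-th power of c_u, the inverse of a is
    [a ^+ (2d - 1)] divided by the 2|a|-th power of c_u. *)
Definition inv_num u (a : Su u) n : Su u :=
  exist _ (val a ^+ d.*2.-1 * cM u ^+ n)
    (S_mem_cX n (S_memX (valP a) d2_gt0)).

Definition invG u (g : Gu u) : Gu u :=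
  frac (inv_num (repr g).1 (repr g).2) (len (piM (val (repr g).1))).*2.

Lemma mulGA u : associative (@mulG u).
Proof.
move=> g h k; elim/frac_ind: g => a m; elim/frac_ind: h => b n.
elim/frac_ind: k => c p.
by rewrite !mulG_frac mulgA addnA.
Qed.

Lemma mul1G u : left_id (@oneG u) (@mulG u).
Proof.
elim/frac_ind => a n; rewrite mulG_frac; apply/fracP.
by rewrite valM /= -[cM u]expg1 cMX_central -mulgA -expgnDr.
Qed.

Lemma mulG1 u : right_id (@oneG u) (@mulG u).
Proof.
elim/frac_ind => a n; rewrite mulG_frac; apply/fracP.
by rewrite valM /= -mulgA -expgS addn1.
Qed.

Lemma inv_num_len u (a : Su u) n :
  (len (piM (val a ^+ d.*2.-1 * cM u ^+ n)%g) + len (piM (val a)) + d =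
   d + ((len (piM (val a))).*2 + n) * d)%N.
Proof.
rewrite len_piM_mul !len_piM_expg len_cM (addnAC (_ * _)%N) -mulSnr prednK.
  by rewrite mulnDl -!doubleMl [(d * _)%N]mulnC [RHS]addnC.
by rewrite double_gt0 d_gt0.
Qed.

Lemma inv_num_lam u (a : Su u) n :
  lamM (val a ^+ d.*2.-1 * cM u ^+ n) * lamM (val a) = 1.
Proof.
rewrite lamM_mul lamM_cMX mul1g lamM_expg -expgSr prednK.
  by rewrite -addnn expgnDr lamM_d mulg1.
by rewrite double_gt0 d_gt0.
Qed.

Lemma mulVG u : left_inverse (@oneG u) (@invG u) (@mulG u).
Proof.
move=> g; rewrite -{2}(frac_repr g) mulG_frac; apply/frac_eqE.
rewrite !valM /= len_piM_mul mul1n len_cM inv_num_len; split=> //.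
rewrite lamM_mul (cM_spec u).2.
by rewrite (canRL (mulgK _) (inv_num_lam _ _)) mul1g mulgV.
Qed.

Lemma mulGV u : right_inverse (@oneG u) (@invG u) (@mulG u).
Proof.
move=> g; rewrite -{1}(frac_repr g) mulG_frac; apply/frac_eqE.
rewrite !valM /= len_piM_mul mul1n len_cM [(len _ + len _)%N]addnC.
rewrite inv_num_len [((repr g).2 + _)%N]addnC; split=> //.
by rewrite lamM_mul (cM_spec u).2 inv_num_lam.
Qed.

HB.instance Definition _ u := isGroup.Build (Gu u)
  (@mulGA u) (@mul1G u) (@mulG1 u) (@mulVG u) (@mulGV u).

Lemma fracM u (a b : Su u) m n : frac a m * frac b n = frac (a * b) (m + n).
Proof. exact: mulG_frac. Qed.

Definition toG u (a : Su u) : Gu u := frac a 0.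

Lemma toGM u (a b : Su u) : toG (a * b) = toG a * toG b.
Proof. by rewrite /toG fracM. Qed.

Lemma toG_inj u : injective (@toG u).
Proof. by move=> a b /fracP; rewrite !mulg1 => /val_inj. Qed.

Lemma fracE u (a : Su u) n : frac a n = toG a * toG (cS u) ^- n.
Proof.
apply: (canRL (mulgK _)); elim: n => [|n IH]; first by rewrite mulg1.
rewrite expgS mulgA -IH; congr (_ * _); rewrite fracM addn0.
by apply/fracP; rewrite valM /= -mulgA -expgS.
Qed.

Definition torsion u : pred (Gu u) :=
  fun g => `[< exists2 n, 0 < n & g ^+ n = 1 >].

Lemma fracX u (a : Su u) m n :
  exists2 b, val b = val a ^+ n.+1 & frac a m ^+ n.+1 = frac b (n.+1 * m).
Proof.
elim: n => [|n [b eb IH]]; first by exists a; rewrite ?mul1n.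
exists (a * b); first by rewrite valM eb -expgS.
by rewrite expgS IH fracM mulSn.
Qed.

Lemma torsion_frac u (a : Su u) n :
  torsion (frac a n) = (len (piM (val a)) == n * d)%N.
Proof.
apply/asboolP/eqP => [[[|k] // _]|ea].
  have [b eb ->] := fracX a n k => /frac_eqE /= [+ _].
  rewrite eb len_piM_expg len_cM mul1n addnC -mulnA => /addnI/eqP.
  by rewrite eqn_mul2l => /eqP.
exists d; first exact: d_gt0.
have := fracX a n d.-1; rewrite prednK ?d_gt0 // => -[b eb ->].
apply/frac_eqE; rewrite eb /= len_piM_expg len_cM ea mulnA mul1n addnC.
by rewrite lamM_expg lamM_d (cM_spec u).2.
Qed.

Lemma torsionM u (g h : Gu u) : torsion g -> torsion h -> torsion (g * h).
Proof.
elim/frac_ind: g => a m; elim/frac_ind: h => b n; rewrite fracM !torsion_frac.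
move=> /eqP ea /eqP eb.
by rewrite valM len_piM_mul ea eb mulnDl.
Qed.

Lemma torsionV u (g : Gu u) : torsion g -> torsion g^-1.
Proof.
move=> /asboolP[n n0 gn]; apply/asboolP; exists n => //.
by rewrite expVgn gn invg1.
Qed.

Lemma torsion_group_closed u : group_closed (@torsion u).
Proof.
split=> [|g h gT hT]; last exact/torsionM/torsionV.
by apply/asboolP; exists 1%N.
Qed.

Definition TGu u : Type := {g : Gu u | torsion g}.
HB.instance Definition _ u := SubChoice.on (TGu u).
HB.instance Definition _ u :=
  SubChoice_isSubGroup.Build (Gu u) (@torsion u) (TGu u)
    (@torsion_group_closed u).

(** T(G_u) is finite: a torsion element a / c_u^n is determined by
    lambda_a(u), since |a| = dn. *)
Definition T_image u (g : TGu u) : X := lamM (val (repr (val g)).1) (val u).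

Lemma T_image_inj u : injective (@T_image u).
Proof.
move=> g h egh; apply: val_inj; rewrite -(frac_repr (val g)).
rewrite -(frac_repr (val h)); apply/frac_eqE; split=> //.
have := valP g; have := valP h.
rewrite -{1}(frac_repr (val g)) -{1}(frac_repr (val h)) !torsion_frac.
by move=> /eqP -> /eqP ->; rewrite -!mulnDl addnC.
Qed.

Definition T_preimage u (x : X) : option (TGu u) :=
  if pselect (exists g : TGu u, T_image g == x) is left ex
  then Some (xchoose ex) else None.

Lemma T_imageK u : pcancel (@T_image u) (@T_preimage u).
Proof.
move=> g; rewrite /T_preimage; case: pselect => [ex|[]]; last by exists g.
by congr Some; apply/T_image_inj/eqP/(xchooseP ex).
Qed.

HB.instance Definition _ u := PCanIsCountable (@T_imageK u).
HB.instance Definition _ u : isFinite (TGu u) := PCanIsFinite (@T_imageK u).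

Definition Xset (u : LambdaT) : {set X} :=
  [set x | lamA (genA x ^+ d) (val u) == x].

Definition XT (u : LambdaT) : finType := {x : X | x \in Xset u}.

(** The element (dx, lambda_{dx}) of M. *)
Definition dM (x : X) : M X := piM_inv (genA x ^+ d).

Lemma S_mem_dM u x : S_mem (val u) (dM x) = (x \in Xset u).
Proof.
have dx1 : dM x != 1 by rewrite -len_piM_gt0 piM_invK len_expg d_gt0.
rewrite inE /lamA; apply/S_memP/eqP => [[_]|ex].
  by rewrite piM_invK len_expg => /(genA_expg_inj (d_gt0 d)).
by rewrite piM_invK len_expg -/(dM x) ex.
Qed.

Lemma dM_S u (x : XT u) : S_mem (val u) (dM (val x)).
Proof. by rewrite S_mem_dM (valP x). Qed.

Definition dS u (x : XT u) : Su u := exist _ (dM (val x)) (dM_S x).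

Lemma t_torsion u (x : XT u) : torsion (toG (dS x) * (toG (cS u))^-1).
Proof.
rewrite -[toG (cS u)]expg1 -fracE torsion_frac /=.
by rewrite piM_invK len_expg mul1n.
Qed.

Definition t_elt u (x : XT u) : TGu u :=
  exist _ (toG (dS x) * (toG (cS u))^-1) (t_torsion x).

Definition Te : Type := {u : LambdaT & TGu u}.

Definition inTe u (g : TGu u) : Te := Tagged (fun u => TGu u) g.

Definition T_part (u : LambdaT) (a : Te) : Prop := tag a = u.

(** The rule t_{u,x} o t_{v,y} = t_{v, lambda_{dx}(y)}; its right-hand side is
    meaningful only if lambda_{dx}(y) lies in X_v. *)
Definition is_torsion_product (op : Te -> Te -> Te) :=
  forall u v (x : XT u) (y : XT v),
    exists2 z : XT v, val z = lamA (genA (val x) ^+ d) (val y) &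
      op (inTe (t_elt x)) (inTe (t_elt y)) = inTe (t_elt z).

End QuotientGroups.

(* Main.v *)
(** Write L_x = lambda_{dx}, a permutation of X, and D x = L_x^{-1}(x), so that
    x lies in X_u exactly when D x = u. Since (dx, L_x) is a product of
    generators, D x lies in Lambda, and L_u = id for u in Lambda because
    c_u = (du, id). Multiplying (dx, L_x) by a power of c_{D x} gives
    (ndx, L_x), so lambda_{ndx} = L_x for all n > 0. Comparing second components
    in (dx, L_x) o (dy, L_y) = (2d L_x(y), L_x L_y) yields
    L_{L_x(y)} = L_x L_y.
    Hence x * y = L_x(y) is an associative product on X whose left translations
    are bijective, the elements of Lambda are left identities, and
    D (x * y) = D y. The map t_{u,x} |-> x is a bijection of T(G^e) onto X which
    turns the product of the statement into *, and x |-> (x * u, D x) is an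
    isomorphism of X onto X_u x Lambda, where Lambda carries the product
    v w = w. *)
Require Import Defs.
From mathcomp Require Import all_boot all_order all_fingroup all_solvable.
From mathcomp Require Import boolp.

Set Implicit Arguments.
Unset Strict Implicit.
Unset Printing Implicit Defensive.

Section TorsionAction.
Local Open Scope group_scope.

Variables (X : solution) (d : exponent_multiple X).
Implicit Types (x y : X) (u v : LambdaT X).

(** * The permutations L_x and the map D *)

(** Only the last letter x of the word matters: if m is the remaining prefix, the relations of A
    force y = [lamM m x], and the inverse permutation of the whole word sends this y to [diag x]. *)
Lemma lamM_piM_expg (m : M X) y n : 0 < n -> piM m = genA y ^+ n ->
  (lamM m)^-1 y \in Lambda X.
Proof.
elim/presented_ind: m => [|m x _] n0 em.
  by move: n0; rewrite -[n](len_expg y) -em piM_one (len_word [::]).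
have en : n = (len (piM m)).+1.
  rewrite -[n](len_expg y) -em piM_mul len_mul len_autA.
  by rewrite piM_gen len_gen addn1.
have -> : y = lamM m x.
  apply: (genA_expg_inj n0).
  by rewrite -em piM_mul piM_gen autA_gen mulA_gen -en.
by rewrite lamM_mul lamM_gen invMg permM permK imset_f.
Qed.

(** This is L_x, and [tdiag] below is D. *)
Definition tact x : {perm X} := lamM (dM d x).

Lemma tact_diag_subproof x : (tact x)^-1 x \in Lambda X.
Proof. by apply: (lamM_piM_expg (d_gt0 d)); rewrite piM_invK. Qed.

Definition tdiag x : LambdaT X :=
  exist (fun z : X => z \in Lambda X) _ (tact_diag_subproof x).

Lemma mem_Xset x u : (x \in Xset d u) = (tdiag x == u).
Proof.
by rewrite inE -val_eqE [RHS]eq_sym; apply: (canF_eq (permK (tact x))).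
Qed.

Lemma tact_tdiag x : tact x (val (tdiag x)) = x.
Proof. exact: permKV. Qed.

Lemma piM_cMX u n : piM (cM d u ^+ n) = genA (val u) ^+ (n * d).
Proof.
elim: n => [|n IH]; first by rewrite piM_one.
by rewrite expgS piM_mul (cM_spec d u).2 autA_id piM_invK IH -expgnDr mulSn.
Qed.

Lemma piM_dM_cMX x n :
  piM (dM d x * cM d (tdiag x) ^+ n) = genA x ^+ (n.+1 * d).
Proof.
rewrite piM_mul piM_cMX autA_expg autA_gen -/(tact x) tact_tdiag piM_invK.
by rewrite -expgnDr mulSn.
Qed.

Lemma lamM_tact (m : M X) x n : piM m = genA x ^+ (n.+1 * d) -> lamM m = tact x.
Proof.
rewrite -piM_dM_cMX => /piM_inj ->.
by rewrite lamM_mul lamM_cMX mul1g.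
Qed.

(** The left factor of a product in [{perm X}] acts first, so the right-hand side is the composite
    L_x L_y. *)
Lemma tact_tact x y : tact (tact x y) = tact y * tact x.
Proof.
(* The product of (dx, L_x) and (dy, L_y) has length 2d, the case [n = 1] of [lamM_tact]. *)
rewrite -lamM_mul; apply/esym/(@lamM_tact _ _ 1).
rewrite piM_mul !piM_invK autA_expg autA_gen -/(tact x).
by rewrite mulA_expg ?d_gt0 // len_expg mul2n addnn.
Qed.

Lemma tact_Lambda u : tact (val u) = 1.
Proof. exact: (cM_spec d u).2. Qed.

Lemma tdiag_tact x y : tdiag (tact x y) = tdiag y.
Proof. by apply: val_inj; rewrite /= tact_tact invMg permM permK. Qed.

Lemma tdiag_Lambda u : tdiag (val u) = u.
Proof. by apply: val_inj; rewrite /= tact_Lambda invg1 perm1. Qed.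

(** * Torsion elements as points of X *)

Lemma T_frac u (g : TGu d u) : exists a n, val g = frac d a n.
Proof. by elim/frac_ind: (val g) => a n; exists a, n. Qed.

(** Equality of fractions frees [T_image] from its chosen representative; torsion makes |a| = nd, so
    [lamM_tact] applies. *)
Lemma T_image_frac u (g : TGu d u) a n : val g = frac d a n ->
  T_image g = lamM (val a) (val u) /\ lamM (val a) = tact (T_image g).
Proof.
move=> eg; have -> : T_image g = lamM (val a) (val u).
  by move: eg; rewrite -(frac_repr (val g)) => /frac_eqE[].
split=> //; have := valP g; rewrite eg torsion_frac => /eqP ea.
have /S_memP[] := valP a; rewrite -len_piM_gt0 ea.
(* Here n = 0 would give |a| = 0, but S_u omits the identity. *)
by case: n {eg ea} => // n _ /lamM_tact.
Qed.

Lemma T_image_Xset u (g : TGu d u) : T_image g \in Xset d u.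
Proof.
have [a [n /T_image_frac[eg ea]]] := T_frac g.
by rewrite inE -[lamA _]/(tact _) -ea -eg.
Qed.

Lemma tdiag_T_image u (g : TGu d u) : tdiag (T_image g) = u.
Proof. by apply/eqP; rewrite -mem_Xset T_image_Xset. Qed.

Lemma T_image_t u (x : XT d u) : T_image (t_elt x) = val x.
Proof.
have e : val (t_elt x) = frac d (dS x) 1 by rewrite fracE.
by have [-> _] := T_image_frac e; have := valP x; rewrite inE => /eqP.
Qed.

Lemma T_imageM u (g h : TGu d u) :
  T_image (g * h) = tact (T_image g) (T_image h).
Proof.
have [a [m eg]] := T_frac g; have [b [n eh]] := T_frac h.
have e : val (g * h) = frac d (a * b) (m + n) by rewrite -fracM -eg -eh.
have [_ eag] := T_image_frac eg; have [ebh _] := T_image_frac eh.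
by have [-> _] := T_image_frac e; rewrite valM lamM_mul permM -ebh eag.
Qed.

Definition Te_image (a : Te d) : X := T_image (tagged a).

Lemma tag_Te_image a : tag a = tdiag (Te_image a).
Proof. by rewrite tdiag_T_image. Qed.

Definition XsetT u x (xu : x \in Xset d u) : XT d u :=
  exist (fun z : X => z \in Xset d u) x xu.

Lemma tdiag_Xset x : x \in Xset d (tdiag x).
Proof. by rewrite mem_Xset. Qed.

Definition Te_elt x : Te d :=
  inTe (t_elt (XsetT (tdiag_Xset x))).

Lemma Te_eltK : cancel Te_elt Te_image.
Proof. by move=> x; apply: T_image_t. Qed.

Lemma Te_image_inj : injective Te_image.
Proof.
move=> [u g] [v h] egh.
(* D of the image recovers the tag. *)
have euv : u = v by move/(congr1 tdiag): (egh); rewrite !tdiag_T_image.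
by case: v / euv h egh => h /T_image_inj /= ->.
Qed.

Lemma Te_imageK : cancel Te_image Te_elt.
Proof. exact: (inj_can_sym Te_eltK Te_image_inj). Qed.

Lemma t_elt_T_image u (x : XT d u) (g : TGu d u) :
  val x = T_image g -> t_elt x = g.
Proof. by move=> ex; apply: T_image_inj; rewrite T_image_t. Qed.

(** Every torsion element is a [t_elt], so the rule fixes [op] on all pairs; conversely, D (x * y) =
    D y puts x * y in X_v. *)
Lemma torsion_productE (op : Te d -> Te d -> Te d) :
  is_torsion_product op <->
  forall a b, Te_image (op a b) = tact (Te_image a) (Te_image b).
Proof.
split=> [opP [u g] [v h]|opP u v x y].
  pose x : XT d u := XsetT (T_image_Xset g).
  pose y : XT d v := XsetT (T_image_Xset h).
  have [z ez] := opP u v x y.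
  have -> : t_elt x = g by exact: t_elt_T_image.
  have -> : t_elt y = h by exact: t_elt_T_image.
  by rewrite -/(inTe g) -/(inTe h) => ->; rewrite /Te_image /= T_image_t ez.
have zv : tact (val x) (val y) \in Xset d v.
  by rewrite mem_Xset tdiag_tact -mem_Xset (valP y).
exists (XsetT zv) => //; apply: Te_image_inj.
by rewrite opP /Te_image /= !T_image_t.
Qed.

(** * Isomorphisms between the groups, and cardinalities *)

Lemma tact_Xset x u : tact x (val u) \in Xset d u.
Proof. by rewrite mem_Xset tdiag_tact tdiag_Lambda. Qed.

(** Right translation x |-> x * u, read in T(G_u). *)
Definition T_proj u x : TGu d u := t_elt (XsetT (tact_Xset x u)).

Lemma T_image_proj u x : T_image (T_proj u x) = tact x (val u).
Proof. exact: T_image_t. Qed.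

(** As u is a left identity, (x * u) * (y * u) = x * (y * u) = (x * y) * u. *)
Lemma T_proj_tact u x y : T_proj u (tact x y) = T_proj u x * T_proj u y.
Proof.
apply: T_image_inj; rewrite T_imageM !T_image_proj !tact_tact.
by rewrite !permM tact_Lambda perm1.
Qed.

(** For x in X_u, (x * v) * u = x * (v * u) = x * u = x, since v is a left identity and D x = u. *)
Lemma T_proj_image u v (g : TGu d u) :
  tact (T_image (T_proj v (T_image g))) (val u) = T_image g.
Proof.
rewrite T_image_proj tact_tact tact_Lambda mul1g.
by rewrite -{2}(tdiag_T_image g) tact_tdiag.
Qed.

Lemma T_proj_imageK u v :
  cancel (fun g : TGu d u => T_proj v (T_image g))
         (fun h : TGu d v => T_proj u (T_image h)).
Proof. by move=> g; apply: T_image_inj; rewrite T_image_proj T_proj_image. Qed.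

Lemma T_isog u v : [set: TGu d u] \isog [set: TGu d v].
Proof.
pose f (g : TGu d u) := T_proj v (T_image g).
have fM : {in [set: TGu d u] &, {morph f : g h / g * h}}.
  by move=> g h _ _; rewrite /f T_imageM T_proj_tact.
apply/isogP; exists (Morphism fM).
  by apply/injmP => g h _ _; apply: (can_inj (@T_proj_imageK u v)).
apply/setP => h; rewrite !inE; apply/morphimP.
exists (T_proj u (T_image h)); rewrite ?inE //=.
by rewrite /f T_proj_imageK.
Qed.

(* With x * y = L_x(y): as x = x * D x and u is a left identity, x is recovered
   from x * u in X_u as (x * u) * D x. *)
Lemma T_proj_tdiagK u :
  cancel (fun x => (T_proj u x, tdiag x))
         (fun p => tact (T_image p.1) (val p.2)).
Proof.
move=> x; rewrite [LHS]/= T_image_proj tact_tact permM.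
by rewrite tact_Lambda perm1 permKV.
Qed.

Lemma T_proj_tdiagVK u :
  cancel (fun p : TGu d u * LambdaT X => tact (T_image p.1) (val p.2))
         (fun x => (T_proj u x, tdiag x)).
Proof.
move=> [g v] /=; rewrite tdiag_tact tdiag_Lambda; congr (_, _).
apply: T_image_inj; rewrite T_image_proj tact_tact tact_Lambda mul1g.
by rewrite -{2}(tdiag_T_image g) tact_tdiag.
Qed.

Lemma card_Lambda : #|{: LambdaT X}| = #|Lambda X|.
Proof. by rewrite card_sig; apply: eq_card => x. Qed.

Lemma card_TGu u : #|X| = (#|Lambda X| * #|{: TGu d u}|)%N.
Proof.
rewrite mulnC -card_Lambda -card_prod.
exact: bij_eq_card (Bijective (@T_proj_tdiagK u) (@T_proj_tdiagVK u)).
Qed.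

Lemma card_Xset u : #|Xset d u| = #|{: TGu d u}|.
Proof.
rewrite -(card_imset _ (@T_image_inj _ _ u)); apply: eq_card => x.
apply/idP/imsetP => [xu|[g _ ->]]; last exact: T_image_Xset.
by exists (t_elt (XsetT xu)); rewrite // T_image_t.
Qed.

(** * Semigroup structure of T(G^e) *)

Section TorsionProduct.
Variable op : Te d -> Te d -> Te d.
Hypothesis opP : is_torsion_product op.

Let opE a b : Te_image (op a b) = tact (Te_image a) (Te_image b).
Proof. by move: a b; apply/torsion_productE. Qed.

Lemma tag_op a b : tag (op a b) = tag b.
Proof. by rewrite !tag_Te_image opE tdiag_tact. Qed.

Lemma op_assoc : associative op.
Proof.
by move=> a b c; apply: Te_image_inj; rewrite !opE tact_tact permM.
Qed.

Lemma op_left_cancellative : left_cancellative op.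
Proof.
move=> a b c /(congr1 Te_image).
by rewrite !opE => /perm_inj/Te_image_inj.
Qed.

(** Left translations are surjective, so the right multiples of a single element already fill
    T(G^e). *)
Lemma op_simple : simple_semigroup op.
Proof.
split=> [|I [[a Ia] IM] b].
  by have /card_gt0P[x _] := sol_nonempty X; exists (Te_elt x).
suff -> : b = op a (Te_elt ((tact (Te_image a))^-1 (Te_image b))).
  exact: (IM _ _ Ia).1.
by apply: Te_image_inj; rewrite opE Te_eltK permKV.
Qed.

Lemma op_inTe u (g h : TGu d u) : op (inTe g) (inTe h) = inTe (g * h).
Proof. by apply: Te_image_inj; rewrite opE /Te_image /= T_imageM. Qed.

Lemma T_part_subgroup u : is_subgroup op (T_part u).
Proof.
split=> [a b _ <-|]; first exact: tag_op.
exists (inTe (1 : TGu d u)) => // -[v g]; rewrite /T_part /= => evu.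
case: u / evu.
rewrite -/(inTe g) !op_inTe mul1g mulg1; split=> //.
by exists (inTe g^-1) => //; rewrite !op_inTe mulgV mulVg.
Qed.

(** A product lies in the component of its right factor, and a = [op a e] for the identity e of
    K. *)
Lemma subgroup_sub_T_part (K : Te d -> Prop) : is_subgroup op K ->
  exists u, forall a, K a -> T_part u a.
Proof.
move=> [_ [e _ Ke]]; exists (tag e) => a /Ke[_ <- _]; exact: tag_op.
Qed.

Lemma maximal_subgroupP (H : Te d -> Prop) :
  is_maximal_subgroup op H <-> exists u, forall a, H a <-> T_part u a.
Proof.
split=> [[Hg Hmax]|[u Hu]].
  have [u Hu] := subgroup_sub_T_part Hg; exists u => a; split; first exact: Hu.
  exact: Hmax (T_part_subgroup u) Hu a.
have -> : H = T_part u by apply: funext => a; apply/propext.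
split=> [|K /subgroup_sub_T_part[v Kv] uK a /Kv va].
  exact: T_part_subgroup.
(* The identity of T(G_u) lies in K, hence in the component of v. *)
by have -> : u = v := Kv (inTe 1) (uK (inTe (1 : TGu d u)) erefl).
Qed.


(** Tags are ranked in the subtype [LambdaT X], while the index counts the set [Lambda X];
    [cast_ord] reconciles the two cardinals. *)
Definition rees_of u (a : Te d) : rees (TGu d u) #|Lambda X| :=
  (T_proj u (Te_image a), ord0, cast_ord card_Lambda (enum_rank (tag a))).

Lemma rees_of_bij u : bijective (@rees_of u).
Proof.
exists (fun p => Te_elt (tact (T_image p.1.1)
  (val (enum_val (cast_ord (esym card_Lambda) p.2))))) => [a|[[g i] j]].
  rewrite /= cast_ordK enum_rankK tag_Te_image.
  by have /= -> := T_proj_tdiagK u (Te_image a); rewrite Te_imageK.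
rewrite /rees_of tag_Te_image Te_eltK.
set v := enum_val _; have [-> ->] := T_proj_tdiagVK (g, v).
by rewrite enum_valK cast_ordKV (ord1 i).
Qed.

Lemma torsion_product_rees u :
  semigroup_iso op (@rees_mul (TGu d u) #|Lambda X|).
Proof.
exists (@rees_of u) => [|a b]; first exact: rees_of_bij.
by rewrite /rees_of /rees_mul /= tag_op opE T_proj_tact.
Qed.

End TorsionProduct.

(** * Existence of the product and the partition of X *)

Lemma torsion_product_exists : exists op : Te d -> Te d -> Te d,
  is_torsion_product op.
Proof.
exists (fun a b => Te_elt (tact (Te_image a) (Te_image b))).
by apply/torsion_productE => a b; rewrite Te_eltK.
Qed.

Lemma bigcup_Xset : \bigcup_(u : LambdaT X) Xset d u = [set: X].
Proof.
apply/setP => x; rewrite inE; apply/bigcupP.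
by exists (tdiag x); last exact: tdiag_Xset.
Qed.

Lemma disjoint_Xset u v : u != v -> [disjoint Xset d u & Xset d v].
Proof.
apply: contraR => /pred0Pn[x /andP[/=]].
by rewrite !mem_Xset => /eqP <-.
Qed.

End TorsionAction.

Theorem lemma3p7 (X : solution) (d : exponent_multiple X) :
  (exists op : Te d -> Te d -> Te d, is_torsion_product op) /\
  forall op : Te d -> Te d -> Te d, is_torsion_product op ->
  [/\ associative op, left_cancellative op & simple_semigroup op] /\
  (forall (u : LambdaT X) (g h : TGu d u),
     op (inTe g) (inTe h) = inTe (g * h)%g) /\
  (forall H : Te d -> Prop,
     is_maximal_subgroup op H <->
     exists u : LambdaT X, forall a, H a <-> T_part u a) /\
  (forall u v : LambdaT X, [set: TGu d u] \isog [set: TGu d v]) /\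
  (forall u : LambdaT X,
     semigroup_iso op (@rees_mul (TGu d u) #|Lambda X|)) /\
  (forall u : LambdaT X, #|X| = #|Lambda X| * #|{: TGu d u}|) /\
  [/\ \bigcup_(u : LambdaT X) Xset d u = [set: X],
      forall u v : LambdaT X, u != v -> [disjoint Xset d u & Xset d v] &
      forall u v : LambdaT X, #|Xset d u| = #|Xset d v| ].
Proof.
split=> [|op opP]; first exact: torsion_product_exists.
split; first by split; [exact: op_assoc | exact: op_left_cancellative
                       | exact: op_simple].
split; first by move=> u g h; apply: op_inTe.
split; first by move=> H; apply: maximal_subgroupP.
split; first exact: T_isog.
split; first by move=> u; apply: torsion_product_rees.
split; first exact: card_TGu.
split; [exact: bigcup_Xset | exact: disjoint_Xset |].
move=> u v; rewrite !card_Xset -!cardsT.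
exact: card_isog (T_isog d u v).
Qed.
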